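(* Let $M\ge N\ge 1$ and $1\le E\le D$ be integers. Let $[A]_{D+E}\in\mathbb{R}^{M\times N}[T]/(T^{D+E})$, let $[R]_D\in\mathbb{R}^{M\times N}[T]/(T^{D})$ be such that $[R_{:N,:}]_D$ (the first $N$ rows) is upper triangular with nonsingular zeroth coefficient $R_{0;:N,:}$, let $[Q]_D\in\mathbb{R}^{M\times M}[T]/(T^{D})$ be orthogonal, and suppose that these satisfy the QR defining equations of order $D$: $$0\overset{D}{=}[Q]_D[R]_D-[A]_D,\qquad 0\overset{D}{=}[Q]_D^T[Q]_D-I,\qquad 0\overset{D}{=}P_L\circ[R]_D .$$ Define $[\Delta F]_E$, $[\Delta G]_E$, $[S]_E$ by $$[\Delta F]_E\,T^D\overset{D+E}{=}-[Q]_D[R]_D+[A]_{D+E},\qquad [\Delta G]_E\,T^D\overset{D+E}{=}-[Q]_D^T[Q]_D+I,\qquad [S]_E\overset{E}{=}\tfrac12[\Delta G]_E,$$ let $[X]_E\in\mathbb{R}^{M\times M}[T]/(T^E)$ be an antisymmetric matrix polynomial whose first $N$ columns satisfy $$P_L\circ[X_{:,:N}]_E\overset{E}{=}P_L\circ\bigl([Q]_E^T[\Delta F]_E[R_{:N,:}]_E^{-1}\bigr)-P_L\circ[S_{:,:N}]_E,$$ and put $$[\Delta R]_E\overset{E}{=}[Q]_E^T[\Delta F]_E-([S]_E+[X]_E)[R]_E,\qquad [\Delta Q]_E\overset{E}{=}[Q]_E([S]_E+[X]_E).$$ Then these formulas give the next $E$ coefficients of the QR decomposition, $[\Delta R]_E\equiv[R]_{D:D+E-1}$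 and $[\Delta Q]_E\equiv[Q]_{D:D+E-1}$; that is, $[Q]_{D+E}:=[Q]_D+[\Delta Q]_ET^D$ and $[R]_{D+E}:=[R]_D+[\Delta R]_ET^D$ satisfy the defining equations of order $D+E$: $$0\overset{D+E}{=}[Q]_{D+E}[R]_{D+E}-[A]_{D+E},\qquad 0\overset{D+E}{=}[Q]_{D+E}^T[Q]_{D+E}-I,\qquad 0\overset{D+E}{=}P_L\circ[R]_{D+E}.$$
   Context: For a real matrix space $V$, an element of $V[T]/(T^D)$ is written $[x]_D=\sum_{d=0}^{D-1}x_dT^d$ with coefficients $x_d\in V$, and is identified with its representing polynomial of degree less than $D$ when it occurs in a relation of higher order. For $K\le D$, $[x]_K$ denotes the truncation $\sum_{d=0}^{K-1}x_dT^d$ of $[x]_D$. $[x]_{i:j}$ denotes the coefficient block $[x_i,\dots,x_j]$, regarded as the polynomial $\sum_{k=i}^{j}x_kT^{k-i}$. The notation $[x]\overset{D}{=}[y]$ means $x_d=y_d$ for $d=0,\dots,D-1$ (equality modulo $T^D$). Products, transposes and inverses of matrix polynomials are the usual ones modulo the indicated power of $T$ (a square matrix polynomial is invertible when its zeroth coefficient is). ''Orthogonal'' for $[Q]_D$ means $[Q]_D^T[Q]_D\overset{D}{=}I$. Indices start at $1$; $R_{:N,:}$ denotes the first $N$ rows of $R$ and $X_{:,:N}$ the first $N$ columns of $X$. $P_L\in\mathbb{R}^{M\times N}$ is the matrix with $(P_L)_{ij}=1$ if $j<i$ and $0$ otherwise; $\circ$ is the elementwise (Hadamard) product, applied coefficientwise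 to matrix polynomials. Thus $P_L\circ R$ extracts the strictly lower triangular part. The antisymmetry of $[X]_E$ together with its prescribed entries determines all of $[X]_E$ except the entries $X_{ij}$ with $i,j>N$, which are not prescribed (they may for instance be set to zero). *)

(* Defs.v *)
From HB Require Import structures.
From mathcomp Require Import all_boot all_order all_algebra.
From mathcomp Require Import reals.

Set Implicit Arguments.
Unset Strict Implicit.
Unset Printing Implicit Defensive.

Import Order.TTheory GRing.Theory Num.Theory.
Local Open Scope ring_scope.

(* A matrix polynomial sum_d A_d T^d is encoded by the matrix of its entries,
   an element of 'M[{poly K}]_(m, n), with T represented by 'X. *)
Section MatrixPolynomials.
Variables (K : fieldType) (m n : nat).
Implicit Types A B : 'M[{poly K}]_(m, n).

Definition coefmx (d : nat) A : 'M[K]_(m, n) := map_mx (coefp d) A.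

(* A is the representing polynomial, of degree less than D, of an element of
   'M[K]_(m, n)[T]/(T^D). *)
Definition deg_lt (D : nat) A : Prop := forall i j, (size (A i j) <= D)%N.

Definition eqT (D : nat) A B : Prop :=
  forall d, (d < D)%N -> coefmx d A = coefmx d B.

Definition trunc (D : nat) A : 'M[{poly K}]_(m, n) := map_mx (take_poly D) A.

(* The block [A_i, ..., A_j], both ends included. *)
Definition block (i j : nat) A : 'M[{poly K}]_(m, n) :=
  map_mx (fun p => take_poly (j.+1 - i) (drop_poly i p)) A.

Definition hadamard (P : 'M[K]_(m, n)) A : 'M[{poly K}]_(m, n) :=
  map2_mx (fun c p => c *: p) P A.

End MatrixPolynomials.

Notation "A =_[ D ] B" := (eqT D A B)
  (at level 70, D at level 200, no associativity,
   format "A  =_[ D ]  B") : ring_scope.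

(* The inverse modulo T^D, computed in the ring of matrices over K[T]/(T^D).
   Since {poly %/ 'X^D} is K[T]/(T) for D = 0, it is meaningful for D >= 1. *)
Definition invmodT (K : fieldType) (n D : nat) (A : 'M[{poly K}]_n) :
    'M[{poly K}]_n :=
  map_mx val (invmx (map_mx (in_qpoly 'X^D) A)).

Lemma coef_in_qpoly (K : fieldType) (D d : nat) (p : {poly K}) :
  (d < D)%N -> (val (in_qpoly 'X^D p))`_d = p`_d.
Proof.
move=> dD; have D_gt0 : (0 < D)%N := leq_ltn_trans (leq0n d) dD.
have mkE : mk_monic ('X^D : {poly K}) = 'X^D.
  by rewrite /mk_monic size_polyXn monicXn ltnS D_gt0.
rewrite /= mkE {2}(Pdiv.RingMonic.rdivp_eq (monicXn K D) p).
by rewrite coefD coefMXn dD add0r.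
Qed.

Lemma mulmx_invmodT (K : fieldType) (n D : nat) (A : 'M[{poly K}]_n) :
  (0 < D)%N -> coefmx 0 A \in unitmx -> A *m invmodT D A =_[D] 1%:M.
Proof.
move=> D_gt0 A0.
have mkE : mk_monic ('X^D : {poly K}) = 'X^D.
  by rewrite /mk_monic size_polyXn monicXn ltnS D_gt0.
pose phi : {rmorphism {poly K} -> {poly %/ ('X^D : {poly K})}} :=
  in_qpoly ('X^D : {poly K}).
have phi_unit : map_mx phi A \in unitmx.
  rewrite unitmxE det_map_mx.
  have ev0 : (fun p : {poly K} => p.[0]) =1 coefp 0.
    by move=> p; rewrite horner_coef0.
  have detA0 : (\det A).[0] != 0.
    rewrite -[_.[0]]/(horner_eval 0 (\det A)) -det_map_mx.
    rewrite (_ : map_mx _ A = coefmx 0 A) -?unitfE -?unitmxE //.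
    by apply/matrixP => i j; rewrite !mxE; apply: ev0.
  change (coprimep (mk_monic ('X^D : {poly K}))
            (val (in_qpoly ('X^D : {poly K}) (\det A)))).
  suff cop (q : {poly K}) : q`_0 != 0 ->
      coprimep (mk_monic ('X^D : {poly K})) q.
    by apply: cop; rewrite coef_in_qpoly // -horner_coef0.
  move=> q0; rewrite mkE; apply: coprimep_expl.
  have := coprimep_XsubC q 0.
  by rewrite coprimep_sym polyC0 subr0 /root horner_coef0 => ->.
have valK (q : {poly %/ ('X^D : {poly K})}) : phi (val q) = q.
  by apply: val_inj; apply: in_qpoly_small; apply: size_mk_monic.
have eq1 : map_mx phi (A *m invmodT D A) = map_mx phi 1%:M.
  rewrite map_mxM map_mx1 -(mulmxV phi_unit); congr (_ *m _).
  by apply/matrixP => i j; rewrite mxE mxE valK.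
move=> d dD; apply/matrixP => i j; rewrite mxE [RHS]mxE.
have /matrixP/(_ i j) := eq1; rewrite mxE [RHS]mxE => eq_ij.
pose coefd (q : {poly %/ ('X^D : {poly K})}) := (val q)`_d.
have := congr1 coefd eq_ij.
by rewrite /coefd !coef_in_qpoly.
Qed.

Definition first_rows (T : Type) (M N n : nat) (hNM : (N <= M)%N)
  (A : 'M[T]_(M, n)) : 'M[T]_(N, n) := rowsub (widen_ord hNM) A.

Definition first_cols (T : Type) (M N m : nat) (hNM : (N <= M)%N)
  (A : 'M[T]_(m, M)) : 'M[T]_(m, N) := colsub (widen_ord hNM) A.

Definition PL {K : fieldType} {M N : nat} : 'M[K]_(M, N) :=
  \matrix_(i < M, j < N) (if (j < i)%N then 1 else 0).

Definition upper_triangular (K : fieldType) (n : nat) (A : 'M[{poly K}]_n) :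
  Prop := is_trig_mx A^T.

Definition orthogonalT (K : fieldType) (n D : nat) (Q : 'M[{poly K}]_n) :
  Prop := Q^T *m Q =_[D] 1%:M.

Definition qr_equations (K : fieldType) (M N D : nat)
    (A : 'M[{poly K}]_(M, N)) (Q : 'M[{poly K}]_M)
    (R : 'M[{poly K}]_(M, N)) : Prop :=
  [/\ 0 =_[D] Q *m R - A,
      0 =_[D] Q^T *m Q - 1%:M
    & 0 =_[D] hadamard PL R].

(* Main.v *)
Require Import Defs.
From HB Require Import structures.
From mathcomp Require Import all_boot all_order all_algebra.
From mathcomp Require Import reals.
From Stdlib Require Import Setoid Morphisms.

(** The proof is one Newton step of order [E <= D].  In the product of two
    factors known modulo [T^D], corrections [T^D dA] and [T^D dB] only enter
    linearly modulo [T^(D+E)], because the quadratic term carries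
    [T^(2D)] (lemma [mulmx_newton_step]).  Hence the equations of order [D+E]
    amount to the linearized equations
      [dQ R + Q dR = dF], [dQ^T Q + Q^T dQ = dG], [P_L o dR = 0]
    modulo [T^E].

    Substituting [dQ = Q (S + X)] and using [Q^T Q = 1], the second one says
    that the symmetric part of [S + X] is [dG / 2]: this is so because [X] is
    antisymmetric and [dG], a defect of orthogonality, is symmetric.  Since [Q]
    is square, [Q Q^T = 1] too ([mulmx1C_modT]), and the first one holds for
    every [X] once [dR = Q^T dF - (S + X) R].  The freedom in [X] is spent on
    the third one.  As the rows of [R] below the square block [R_N] vanish,
    [dR = U R_N] with [U = Q^T dF R_N^-1 - (S + X)_N], where [_N] keeps the
    first [N] columns; the prescribed entries of [X] say exactly that [U] has
    no strictly lower part, and this survives multiplication by the upper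
    triangular [R_N] ([hadamard_PL_mulmx]). *)

Set Implicit Arguments.
Unset Strict Implicit.
Unset Printing Implicit Defensive.

Import Order.TTheory GRing.Theory Num.Theory.
Local Open Scope ring_scope.

(** * Congruence of matrix polynomials modulo a power of T *)

Section Congruence.
Variable K : fieldType.

Section Additive.
Variables m n D : nat.
Implicit Types A B C : 'M[{poly K}]_(m, n).

Lemma eqT_coefP A B :
  A =_[D] B <-> forall i j d, (d < D)%N -> (A i j)`_d = (B i j)`_d.
Proof.
split=> [eqAB i j d dD | eqAB d dD].
  by have /matrixP/(_ i j) := eqAB d dD; rewrite !mxE.
by apply/matrixP=> i j; rewrite !mxE; apply: eqAB.
Qed.

(** Divisibility by [T^D] is the form of the congruence that is compatible
    with products without any convolution of coefficients. *)
Lemma eqTP A B : A =_[D] B <-> exists C, A = B + 'X^D *: C.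
Proof.
split=> [/eqT_coefP eqAB | [C ->]]; last first.
  by apply/eqT_coefP=> i j d dD; rewrite !mxE coefD coefXnM dD addr0.
exists (map_mx (drop_poly D) (A - B)); apply/matrixP=> i j; rewrite !mxE.
apply/eqP; rewrite addrC -subr_eq mulrC.
rewrite -[X in X == _](poly_take_drop D) -[X in _ == X]add0r (inj_eq (addIr _)).
apply/eqP/polyP=> d; rewrite coef_take_poly coefB coef0.
by case: ifP => // dD; rewrite eqAB ?subrr.
Qed.

#[global] Instance eqT_equivalence : Equivalence (@eqT K m n D).
Proof.
split=> [A d // | A B eqAB d dD | A B C eqAB eqBC d dD].
  by rewrite eqAB.
by rewrite eqAB ?eqBC.
Qed.

#[global] Instance eqT_add :
  Proper (@eqT K m n D ==> @eqT K m n D ==> @eqT K m n D) +%R.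
Proof.
move=> _ A /eqTP[A' ->] _ B /eqTP[B' ->]; apply/eqTP; exists (A' + B').
by rewrite addrACA scalerDr.
Qed.

#[global] Instance eqT_opp : Proper (@eqT K m n D ==> @eqT K m n D) -%R.
Proof.
by move=> _ A /eqTP[A' ->]; apply/eqTP; exists (- A'); rewrite opprD scalerN.
Qed.

#[global] Instance eqT_scale (c : {poly K}) :
  Proper (@eqT K m n D ==> @eqT K m n D) ( *:%R c).
Proof.
move=> _ A /eqTP[A' ->]; apply/eqTP; exists (c *: A').
by rewrite scalerDr !scalerA mulrC.
Qed.

Lemma eqT_sub0 A B : 0 =_[D] A - B <-> A =_[D] B.
Proof.
by split=> [eq0 | ->]; rewrite ?subrr // -[A](subrK B) -eq0 add0r.
Qed.

Lemma trunc_eqT A : trunc D A =_[D] A.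
Proof.
by apply/eqT_coefP=> i j d dD; rewrite mxE coef_take_poly dD.
Qed.

Lemma deg_lt_eqT_eq A B : deg_lt D A -> deg_lt D B -> A =_[D] B -> A = B.
Proof.
move=> A_deg B_deg /eqT_coefP eqAB.
apply/matrixP=> i j; apply/polyP=> d; have [dD | Dd] := ltnP d D.
  exact: eqAB.
by rewrite !nth_default // (leq_trans _ Dd).
Qed.

End Additive.

#[global] Instance eqT_trmx m n D : Proper (@eqT K m n D ==> @eqT K n m D) trmx.
Proof.
by move=> _ A /eqTP[A' ->]; apply/eqTP; exists A'^T; rewrite linearD linearZ.
Qed.

#[global] Instance eqT_mulmx m n p D :
  Proper (@eqT K m n D ==> @eqT K n p D ==> @eqT K m p D) mulmx.
Proof.
move=> _ A /eqTP[A' ->] _ B /eqTP[B' ->]; apply/eqTP.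
exists (A' *m B + A *m B' + 'X^D *: (A' *m B')).
rewrite mulmxDl !mulmxDr -!scalemxAl -!scalemxAr !scalerDr.
by rewrite -!addrA; congr (_ + _); rewrite addrCA.
Qed.

Lemma eqT_leq m n D E (A B : 'M[{poly K}]_(m, n)) :
  (E <= D)%N -> A =_[D] B -> A =_[E] B.
Proof. by move=> ED eqAB d dE; apply/eqAB/(leq_trans dE). Qed.

Lemma eqT_shift m n D E (A B : 'M[{poly K}]_(m, n)) :
  'X^D *: A =_[D + E] 'X^D *: B <-> A =_[E] B.
Proof.
split=> [/eqT_coefP eqAB | /eqTP[C ->]]; last first.
  by apply/eqTP; exists C; rewrite scalerDr scalerA exprD.
apply/eqT_coefP=> i j d dE; have := eqAB i j (D + d)%N.
by rewrite ltn_add2l dE !mxE !coefXnM ltnNge leq_addr addKn; apply.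
Qed.

(** One-sided inverses of square matrix polynomials are two-sided: a left
    inverse agrees with the right inverse that exists as soon as the zeroth
    coefficient is invertible. *)
Lemma mulmx1C_modT n D (A B : 'M[{poly K}]_n) :
  A *m B =_[D] 1%:M -> B *m A =_[D] 1%:M.
Proof.
case: D => [|D] AB1; first by move=> d.
have coef0M (C C' : 'M[{poly K}]_n) :
    coefmx 0 (C *m C') = coefmx 0 C *m coefmx 0 C'.
  apply/matrixP=> i j; rewrite !mxE /= coef_sum.
  by apply: eq_bigr => k _; rewrite !mxE coef0M.
have B0_unit : coefmx 0 B \in unitmx.
  have := AB1 0 isT; rewrite coef0M.
  suff -> : coefmx 0 (1%:M : 'M[{poly K}]_n) = 1%:M by move/mulmx1_unit=> [].
  by apply/matrixP=> i j; rewrite !mxE /= coefMn coefC.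
have BV := mulmx_invmodT (ltn0Sn D) B0_unit.
suff -> : A =_[D.+1] invmodT D.+1 B by [].
by rewrite -[X in eqT _ X]mulmx1 -BV mulmxA AB1 mul1mx.
Qed.

(** The quadratic term of the expansion is a multiple of [T^(D + D)], and it
    vanishes because [E <= D]. *)
Lemma mulmx_newton_step m n p D E (A dA : 'M[{poly K}]_(m, n))
    (B dB : 'M[{poly K}]_(n, p)) : (E <= D)%N ->
  (A + 'X^D *: dA) *m (B + 'X^D *: dB)
    =_[D + E] A *m B + 'X^D *: (dA *m B + A *m dB).
Proof.
move=> ED; apply/(eqT_leq (D := D + D)); first by rewrite leq_add2l.
apply/eqTP; exists (dA *m dB).
rewrite mulmxDl !mulmxDr -!scalemxAl -!scalemxAr scalerA -exprD scalerDr.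
by rewrite -!addrA; congr (_ + _); rewrite addrCA.
Qed.

Lemma block_lift m n D E (A dA : 'M[{poly K}]_(m, n)) : (0 < E)%N ->
  deg_lt D A -> deg_lt E dA -> block D (D + E - 1) (A + 'X^D *: dA) = dA.
Proof.
move=> E_gt0 A_deg dA_deg; apply/matrixP=> i j; rewrite !mxE.
have -> : ((D + E - 1).+1 - D = E)%N.
  by rewrite subn1 prednK ?addn_gt0 ?E_gt0 ?orbT // addKn.
apply/polyP=> d; rewrite coef_take_poly coef_drop_poly coefD coefXnM.
rewrite [(d + D < D)%N]ltnNge leq_addl addnK [(A i j)`_ _]nth_default; last first.
  exact: leq_trans (A_deg i j) (leq_addl _ _).
by case: ltnP => [_ | Ed]; rewrite ?add0r // nth_default // (leq_trans _ Ed).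
Qed.

(** * Strictly lower triangular parts *)

Lemma hadamard_PLD m n (A B : 'M[{poly K}]_(m, n)) :
  hadamard PL (A + B) = hadamard PL A + hadamard PL B.
Proof. by apply/matrixP=> i j; rewrite !mxE scalerDr. Qed.

Lemma hadamard_PLZ m n c (A : 'M[{poly K}]_(m, n)) :
  hadamard PL (c *: A) = c *: hadamard PL A.
Proof. by apply/matrixP=> i j; rewrite !mxE scalerAr. Qed.

#[global] Instance eqT_hadamard_PL m n D :
  Proper (@eqT K m n D ==> @eqT K m n D) (hadamard PL).
Proof.
move=> A B /eqT_coefP eqAB; apply/eqT_coefP=> i j d dD.
by rewrite !mxE !coefZ eqAB.
Qed.

(** In the entry [(i, j)] of the product with [j < i], every index [k] has
    either [k < i], killing the left factor, or [j < k], killing the right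
    one. *)
Lemma hadamard_PL_mulmx m n D (A : 'M[{poly K}]_(m, n))
    (B : 'M[{poly K}]_n) :
  hadamard PL A =_[D] 0 -> upper_triangular B -> hadamard PL (A *m B) =_[D] 0.
Proof.
move=> /eqT_coefP lowA /is_trig_mxP upB; apply/eqT_coefP=> i j d dD.
rewrite !mxE; case: ifP => [ji | _]; last by rewrite scale0r.
rewrite scale1r coef_sum coef0 big1 // => k _.
have [ki | ik] := ltnP k i; last first.
  by have := upB j k (leq_trans ji ik); rewrite mxE => ->; rewrite mulr0 coef0.
rewrite coefM big1 // => l _.
have lD : (l < D)%N by apply: leq_ltn_trans dD; rewrite -ltnS.
by have := lowA i k l lD; rewrite !mxE ki scale1r coef0 => ->; rewrite mul0r.
Qed.

(** The strictly lower part contains every row below the first [N] ones, so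
    these rows of [B] vanish. *)
Lemma mulmx_first_rows m M N (hNM : (N <= M)%N) (A : 'M[{poly K}]_(m, M))
    (B : 'M[{poly K}]_(M, N)) :
  hadamard PL B = 0 -> A *m B = first_cols hNM A *m first_rows hNM B.
Proof.
move=> lowB; apply/matrixP=> i j; rewrite !mxE.
have B0 (k : 'I_M) : (N <= k)%N -> B k j = 0.
  move=> Nk; have /matrixP/(_ k j) := lowB.
  by rewrite !mxE (leq_trans (ltn_ord j) Nk) scale1r.
rewrite (bigID (fun k : 'I_M => (k < N)%N)) /= [X in _ + X]big1 ?addr0; last first.
  by move=> k; rewrite -leqNgt => /B0->; rewrite mulr0.
rewrite (big_ord_narrow hNM).
by apply: eq_bigr => k _; rewrite !mxE.
Qed.

End Congruence.

(** * The linearized QR equations *)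

Section LinearizedEquations.
Variable K : fieldType.

Lemma defect_symmetric n D E (Q G : 'M[{poly K}]_n) :
  'X^D *: G =_[D + E] - (Q^T *m Q) + 1%:M -> G^T =_[E] G.
Proof.
move=> G_def; apply/(eqT_shift D).
rewrite -linearZ /= {1}G_def.
by rewrite linearD linearN /= trmx_mul trmxK trmx1 G_def.
Qed.

(** The two summands are [(S + X)^T] and [S + X] because [Q] cancels; [X]
    drops out by antisymmetry and the halves [S^T] and [S] add up to [G]. *)
Lemma linearized_orthogonality n E (Q G S X dQ : 'M[{poly K}]_n) :
  2 != 0 :> K -> Q^T *m Q =_[E] 1%:M -> G^T =_[E] G ->
  S =_[E] (2^-1)%:P *: G -> X^T = - X -> dQ =_[E] Q *m (S + X) ->
  dQ^T *m Q + Q^T *m dQ =_[E] G.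
Proof.
move=> nz2 QtQ G_sym S_def X_anti ->.
rewrite trmx_mul -mulmxA [Q^T *m (Q *m _)]mulmxA QtQ mulmx1 mul1mx linearD /= X_anti.
rewrite addrACA addNr addr0 S_def linearZ /= G_sym -scalerDl -polyCD.
by rewrite -mulr2n -(mulr_natl 2^-1) mulfV // scale1r.
Qed.

Lemma linearized_factorization M N E (Q Y dQ : 'M[{poly K}]_M)
    (R F dR : 'M[{poly K}]_(M, N)) :
  Q *m Q^T =_[E] 1%:M -> dQ =_[E] Q *m Y ->
  dR =_[E] Q^T *m F - Y *m R -> dQ *m R + Q *m dR =_[E] F.
Proof.
move=> QQt -> ->.
by rewrite mulmxBr !mulmxA QQt mul1mx addrC subrK.
Qed.

(** Inserting [V R_N = 1] after [B] exhibits [dR] as a product with [R_N] on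
    the right, and the condition on [Y] says that its left factor
    [B V - Y_N] has no strictly lower part. *)
Lemma linearized_triangularity M N E (hNM : (N <= M)%N)
    (B R dR : 'M[{poly K}]_(M, N)) (Y : 'M[{poly K}]_M) (V : 'M[{poly K}]_N) :
  hadamard PL R = 0 -> upper_triangular (first_rows hNM R) ->
  V *m first_rows hNM R =_[E] 1%:M ->
  hadamard PL (first_cols hNM Y) =_[E] hadamard PL (B *m V) ->
  dR =_[E] B - Y *m R -> hadamard PL dR =_[E] 0.
Proof.
move=> lowR upR VR Y_def ->.
rewrite (mulmx_first_rows hNM _ lowR) -[B in B - _]mulmx1 -VR mulmxA -mulmxBl.
apply: hadamard_PL_mulmx upR.
by rewrite hadamard_PLD -scaleN1r hadamard_PLZ Y_def scaleN1r subrr.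
Qed.

End LinearizedEquations.

Theorem proposition1 (K : realType) (M N D E : nat)
  (hN : (1 <= N)%N) (hNM : (N <= M)%N) (hE : (1 <= E)%N) (hED : (E <= D)%N)
  (A : 'M[{poly K}]_(M, N)) (Q : 'M[{poly K}]_M) (R : 'M[{poly K}]_(M, N))
  (A_deg : deg_lt (D + E) A) (Q_deg : deg_lt D Q) (R_deg : deg_lt D R)
  (R_upper : upper_triangular (first_rows hNM R))
  (R_nonsing : coefmx 0 (first_rows hNM R) \in unitmx)
  (Q_orth : orthogonalT D Q)
  (QR_D : qr_equations D (trunc D A) Q R)
  (dF : 'M[{poly K}]_(M, N)) (dG S X : 'M[{poly K}]_M)
  (dF_deg : deg_lt E dF) (dG_deg : deg_lt E dG)
  (S_deg : deg_lt E S) (X_deg : deg_lt E X)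
  (dF_def : 'X^D *: dF =_[D + E] - (Q *m R) + A)
  (dG_def : 'X^D *: dG =_[D + E] - (Q^T *m Q) + 1%:M)
  (S_def : S =_[E] (2^-1)%:P *: dG)
  (X_anti : X^T = - X)
  (X_def : hadamard PL (first_cols hNM X) =_[E]
             hadamard PL ((trunc E Q)^T *m dF
                            *m invmodT E (trunc E (first_rows hNM R)))
             - hadamard PL (first_cols hNM S))
  (dR : 'M[{poly K}]_(M, N)) (dQ : 'M[{poly K}]_M)
  (dR_deg : deg_lt E dR) (dQ_deg : deg_lt E dQ)
  (dR_def : dR =_[E] (trunc E Q)^T *m dF - (S + X) *m trunc E R)
  (dQ_def : dQ =_[E] trunc E Q *m (S + X)) :
  let Q' := Q + 'X^D *: dQ in
  let R' := R + 'X^D *: dR in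
  [/\ block D (D + E - 1) R' = dR,
      block D (D + E - 1) Q' = dQ
    & qr_equations (D + E) A Q' R'].
Proof.
move=> Q' R'; have [_ _ lowR_D] := QR_D.
(* The degree bound on R turns the congruence into an equality, so that the
   lower part of R contributes nothing at the orders D to D + E - 1. *)
have lowR : hadamard PL R = 0.
  apply: (@deg_lt_eqT_eq _ _ _ D) => [i j | i j |]; last by symmetry.
    by rewrite !mxE (leq_trans (size_scale_leq _ _)).
  by rewrite mxE size_poly0.
have truncQ := trunc_eqT (D := E) Q; have truncR := trunc_eqT (D := E) R.
have QtQ : Q^T *m Q =_[E] 1%:M := eqT_leq hED Q_orth.
have QQt : Q *m Q^T =_[E] 1%:M := mulmx1C_modT QtQ.
have dQE : dQ =_[E] Q *m (S + X) by rewrite dQ_def truncQ.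
have dRE : dR =_[E] Q^T *m dF - (S + X) *m R by rewrite dR_def truncQ truncR.
split; [exact: block_lift | exact: block_lift | split].
- apply/eqT_sub0; rewrite /Q' /R' (mulmx_newton_step _ _ _ _ hED).
  have /eqT_shift-> := linearized_factorization QQt dQE dRE.
  by rewrite dF_def addNKr.
- apply/eqT_sub0; rewrite /Q' [(Q + _)^T]linearD linearZ /=.
  rewrite (mulmx_newton_step _ _ _ _ hED).
  have nz2 : 2 != 0 :> K by rewrite pnatr_eq0.
  have dG_sym := defect_symmetric dG_def.
  have /eqT_shift-> :=
    linearized_orthogonality nz2 QtQ dG_sym S_def X_anti dQE.
  by rewrite dG_def addNKr.
- rewrite /R' hadamard_PLD lowR add0r hadamard_PLZ
    -[0 in X in eqT _ X](scaler0 _ 'X^D).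
  apply/eqT_shift; symmetry.
  pose RN := first_rows hNM R; pose V := invmodT E (trunc E RN).
  have VRN : V *m RN =_[E] 1%:M.
    have truncRN := trunc_eqT (D := E) RN.
    apply: mulmx1C_modT; rewrite -{1}truncRN.
    by apply: mulmx_invmodT => //; rewrite (truncRN 0).
  apply: (linearized_triangularity lowR R_upper VRN) dRE.
  have -> : first_cols hNM (S + X) = first_cols hNM S + first_cols hNM X.
    by apply/matrixP=> i j; rewrite !mxE.
  by rewrite hadamard_PLD X_def addrC subrK truncQ.
Qed.
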